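(* Let $H\in\mathbb{R}^{N\times M}$ have positive entries, let $y\in\mathbb{R}^N$, $y\neq0$, be data with nonnegative components, and fix $\tau>0$ and an initialization $x^{(0)}$ with positive components. Consider the Poisson discrepancy criterion: stop EM at the first iteration $k$ such that $$\frac{2}{N}\sum_{i=1}^N \Big( y_i\log\frac{y_i}{(Hx^{(k)})_i}+(Hx^{(k)})_i-y_i\Big)\le \tau ,$$ where $x^{(k)}$ is the EM iteration for the data $y$. Then EM supplied with the Poisson discrepancy criterion is a well-defined regularization method for the constrained maximum likelihood problem with Poisson noise if and only if $y\in H(\mathcal{C})$.
   Context: Products and quotients of vectors are taken componentwise; $1$ is the vector of ones; $\mathcal{C}=\{x\in\mathbb{R}^M : x_j\ge 0\ \forall j\}$ and $H(\mathcal{C})=\{Hx : x\in\mathcal{C}\}$. In the Poisson model the data are independent Poisson variables with means $(Hx)_i$, and the constrained maximum likelihood problem is to minimize over $x\in\mathcal{C}$ the Kullback–Leibler divergence $D_{KL}(y,x)=\sum_{i=1}^N \big( y_i\log\frac{y_i}{(Hx)_i}+(Hx)_i-y_i\big)$, with the conventions $0\log(0/t)=0$ for $t\ge0$ and $s\log(s/0)=+\infty$ for $s>0$. EM is the iteration $x^{(k+1)}=\dfrac{x^{(k)}}{H^T1}\,H^T\dfrac{y}{Hx^{(k)}}$. It is a known fact, taken for granted, that EM converges to a minimizer of $D_{KL}(y,\cdot)$ over $\mathcal{C}$. Definition (regularization method). An iterative method with a stopping rule is a regularization method if (1) the iterates $y\mapsto x^{(k)}$ are defined for all data $y$ of the form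 $Hx$, $x\in\mathcal{C}\setminus\{0\}$; and (2) the stopping rule selects an iteration index such that the stopped iterate tends (asymptotically) to a solution $\hat x$ of the constrained maximum likelihood problem as the coefficient of variation $\delta$ (standard deviation divided by mean) tends to zero. In the Poisson case $\delta\to0$ means that the data tend to infinity, i.e. $y$ is replaced by $y_L=Ly$ with $L\to\infty$. Denote by $x_L^{(k)}$ the EM iterates for the data $y_L$ with the same initialization $x^{(0)}$. Then (2) reads: for every $L>0$ some iteration satisfies the stopping inequality written with $y_L$ and $x_L^{(k)}$ in place of $y$ and $x^{(k)}$, and, writing $k(L)$ for the first such iteration, $\lim_{L\to\infty}\frac1L x_L^{(k(L))}=\hat x$ for some minimizer $\hat x$ of $D_{KL}(y,\cdot)$ over $\mathcal{C}$. *)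

(* Defs.v *)
From mathcomp Require Import all_boot all_order all_algebra.
From mathcomp Require Import all_classical all_reals all_analysis.
Import Order.TTheory GRing.Theory Num.Theory.
Import numFieldNormedType.Exports.

Set Implicit Arguments.
Unset Strict Implicit.
Unset Printing Implicit Defensive.

Local Open Scope classical_set_scope.
Local Open Scope ring_scope.

Definition nonneg_orthant (R : realType) (M : nat) : set 'cV[R]_M :=
  [set x | forall j, 0 <= x j 0].

Arguments nonneg_orthant : clear implicits.

(* s log (s / t) for s, t >= 0, with 0 log (0 / t) = 0 for every t >= 0 and
   s log (s / 0) = +oo for s > 0. *)
Definition xlog_ratio (R : realType) (s t : R) : \bar R :=
  if s == 0 then 0%E else if t == 0 then +oo%E else (s * ln (s / t))%:E.

Definition KL_div (R : realType) (N M : nat) (H : 'M[R]_(N, M))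
    (y : 'cV[R]_N) (x : 'cV[R]_M) : \bar R :=
  (\sum_(i < N)
     (xlog_ratio (y i 0%R) ((H *m x) i 0%R)
      + ((H *m x) i 0%R)%:E - (y i 0%R)%:E))%E.

Definition ML_solution (R : realType) (N M : nat) (H : 'M[R]_(N, M))
    (y : 'cV[R]_N) (x : 'cV[R]_M) : Prop :=
  nonneg_orthant R M x /\
  forall z : 'cV[R]_M, nonneg_orthant R M z -> (KL_div H y x <= KL_div H y z)%E.

Definition EM_step (R : realType) (N M : nat) (H : 'M[R]_(N, M))
    (y : 'cV[R]_N) (x : 'cV[R]_M) : 'cV[R]_M :=
  \col_j (x j 0 / (H^T *m const_mx 1 : 'cV[R]_M) j 0
          * (H^T *m \col_i (y i 0 / (H *m x) i 0)) j 0).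

Definition EM_iterate (R : realType) (N M : nat) (H : 'M[R]_(N, M))
    (x0 : 'cV[R]_M) (y : 'cV[R]_N) (k : nat) : 'cV[R]_M :=
  iter k (EM_step H y) x0.

(* Division is total (with value 0 at a zero denominator), so EM_iterate is
   always a vector; the k-th iterate is defined in the mathematical sense when
   no zero denominator occurs in the k steps leading to it. *)
Definition EM_defined (R : realType) (N M : nat) (H : 'M[R]_(N, M))
    (x0 : 'cV[R]_M) (y : 'cV[R]_N) (k : nat) : Prop :=
  forall l : nat, (l < k)%N ->
    (forall j, (H^T *m const_mx 1 : 'cV[R]_M) j 0 != 0) /\
    (forall i, (H *m EM_iterate H x0 y l) i 0 != 0).

Definition poisson_discrepancy (R : realType) (N M : nat)
    (H : 'M[R]_(N, M)) (x0 : 'cV[R]_M) (tau : R) (y : 'cV[R]_N) (k : nat)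
    : Prop :=
  ((2 / N%:R)%:E * KL_div H y (EM_iterate H x0 y k) <= tau%:E)%E.

(* An iterate that is not defined does not satisfy the criterion. *)
Definition stopping_index (defined criterion : nat -> Prop) (k : nat) : Prop :=
  [/\ defined k, criterion k &
      forall l : nat, (l < k)%N -> ~ (defined l /\ criterion l)].

(* An iterative method with a stopping rule is given by its iterates, by the
   predicate telling which iterates are defined, and by the stopping criterion,
   each as a function of the data and of the iteration index.
   The function k is determined on L > 0, by minimality, and such a function
   exists if and only if for every L > 0 some iteration satisfies the
   criterion. *)
Definition regularization_method (R : realType) (N M : nat)
    (H : 'M[R]_(N, M)) (iterate : 'cV[R]_N -> nat -> 'cV[R]_M)
    (defined criterion : 'cV[R]_N -> nat -> Prop) (y : 'cV[R]_N) : Prop :=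
  (forall x : 'cV[R]_M, nonneg_orthant R M x -> x != 0 ->
     forall k : nat, defined (H *m x) k) /\
  exists k : R -> nat,
    (forall L : R, 0 < L ->
       stopping_index (defined (L *: y)) (criterion (L *: y)) (k L)) /\
    exists xhat : 'cV[R]_M,
      ML_solution H y xhat /\
      (L^-1 *: iterate (L *: y) (k L)) @[L --> +oo] --> xhat.

(* Main.v *)
Require Import Defs.
From mathcomp Require Import all_boot all_order all_algebra.
From mathcomp Require Import all_classical all_reals all_analysis.
From mathcomp Require Import ring lra.
Import Order.TTheory GRing.Theory Num.Theory.
Import numFieldNormedType.Exports.
Local Open Scope classical_set_scope.
Local Open Scope ring_scope.

Set Implicit Arguments.
Unset Strict Implicit.

(** Everything rests on the bound [(sqrt s - sqrt t)^2 <= s ln (s / t) + t - s].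
    If the stopped iterates for the data [L y] satisfy the criterion, dividing
    it by [L] shows that the square roots of the entries of [H z_L], with
    [z_L = x_L / L], are within [O(L^(-1/2))] of those of [y]; hence
    [H xhat = y] in the limit.

    Conversely let [y = H p].  Jensen's inequality for [ln] gives
    [D(q, EM x) + KL(y, H x) <= D(q, x)] for every [q >= 0] with [H q = y],
    where [D] is the Kullback-Leibler divergence weighted by [H^T 1].  Taking
    [q = p], the divergences [KL(y, H x_k)] tend to 0, so [y] is matched at
    every cluster point [xhat] of the iterates; taking [q = xhat], the monotone
    sequence [D(xhat, x_k)] tends to 0, so the iterates converge to [xhat].
    Since [x_L^(k) = L x^(k)] for [k >= 1], the criterion is eventually met for
    every [L], and a fixed index [k] with [H x^(k) <> y] is excluded for large
    [L], whereas [H x^(k) = y] makes [x^(k)] a fixed point, equal to [xhat]. *)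

(** * Sums, entrywise limits and compactness in finite dimension *)

Lemma sumr_gt0 (R : numDomainType) (I : finType) (F : I -> R) (i : I) :
  (forall j, 0 <= F j) -> 0 < F i -> 0 < \sum_j F j.
Proof.
by move=> F0 Fi; rewrite (bigD1 i)//= ltr_pwDl// sumr_ge0.
Qed.

Lemma cvg_mx (R : realType) (T : Type) (F : set_system T) {FF : Filter F}
    (m n : nat) (f : T -> 'M[R]_(m, n)) (A : 'M[R]_(m, n)) :
  (forall i j, f x i j @[x --> F] --> A i j) -> f @ F --> A.
Proof.
move=> fA; apply/cvg_mx_entourageP => E entE.
apply: filter_forall => i; apply: filter_forall => j.
exact: (fA i j _ (nbhs_entourage _ entE)).
Qed.

(** The box with sides [[- B, B]] is compact by [rV_compact], which concerns row vectors; hence the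
    transposes. A cluster point of the sequence is met by every tail. *)
Lemma bounded_seq_cluster (R : realType) (n : nat)
    (u : nat -> 'cV[R]_n) (B : R) :
  (forall k j, `|u k j 0| <= B) ->
  exists c : 'cV[R]_n, forall e, 0 < e -> forall K : nat,
    exists2 k, (K <= k)%N & forall j, `|c j 0 - u k j 0| < e.
Proof.
move=> uB.
pose A := [set v : 'rV[R]_n | forall i, `[- B, B]%classic (v ord0 i)].
have cA : compact A.
  apply: (@rV_compact R n (fun=> `[- B, B]%classic)) => _.
  exact: segment_compact.
have FA : \forall k \near \oo, A (u k)^T.
  by apply: nearW => k i; rewrite /= mxE in_itv/= -ler_norml.
have [c [_ clc]] := cA ((fun k => (u k)^T) @ \oo) _ FA.
exists c^T => e e0 K.
have : \forall v \near (c : 'rV[R]_n),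
    forall j, `|c ord0 j - (v : 'rV[R]_n) ord0 j| < e.
  apply: (@filter_forall 'rV[R]_n 'I_n
    (fun j v => `|c ord0 j - v ord0 j| < e) (nbhs c) _) => j.
  have /cvgrPdist_lt/(_ _ e0) := @coord_continuous R _ _ ord0 j c; exact.
have FK : ((fun k => (u k)^T) @ \oo) [set (u k)^T | k in [set k | (K <= k)%N]].
  by exists K => // k /= Kk; exists k.
move=> /(clc _ _ FK)[_ [[k /= Kk <-]] ck].
by exists k => // j; have := ck j; rewrite !mxE.
Qed.

(** Picking [phi m >= m] within [1 / (m + 1)] of the cluster point suffices: [phi] tends to
    infinity, though it may fail to be monotone. *)
Lemma bounded_seq_cvg_subseq (R : realType) (n : nat)
    (u : nat -> 'cV[R]_n) (B : R) :
  (forall k j, `|u k j 0| <= B) ->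
  exists c : 'cV[R]_n, exists2 phi : nat -> nat,
    phi @ \oo --> \oo & (u \o phi) @ \oo --> c.
Proof.
move=> /bounded_seq_cluster[c uc].
have /choice[phi phiP] m : exists k, (m <= k)%N /\
    forall j, `|c j 0 - u k j 0| < m.+1%:R^-1.
  have m0 : (0 : R) < m.+1%:R^-1 by rewrite invr_gt0.
  by have [k mk ck] := uc _ m0 m; exists k.
exists c; exists phi.
  apply/cvgnyPge => K; near=> m; apply: leq_trans (proj1 (phiP m)).
  by near: m; exists K.
apply: cvg_mx => j k; rewrite (ord1 k); apply/cvgrPdist_lt => e e0.
near=> m; apply: lt_trans (proj2 (phiP m) j) _.
by near: m; exact: near_infty_natSinv_lt (PosNum e0).
Unshelve. all: end_near. Qed.

Lemma cvg_sum (R : realType) (T I : Type) (F : set_system T) {FF : Filter F}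
    (r : seq I) (f : I -> T -> R) (l : I -> R) :
  (forall i, f i @ F --> l i) ->
  (\sum_(i <- r) f i x) @[x --> F] --> \sum_(i <- r) l i.
Proof.
move=> fl; elim: r => [|i r IH].
  by rewrite big_nil; under eq_fun do rewrite big_nil; exact: cvg_cst.
by rewrite big_cons; under eq_fun do rewrite big_cons; exact: cvgD.
Qed.

Lemma cvg_mulmx (R : realType) (T : Type) (F : set_system T) {FF : Filter F}
    (m n : nat) (A : 'M[R]_(m, n)) (f : T -> 'cV[R]_n) (x : 'cV[R]_n) :
  f @ F --> x -> A *m f t @[t --> F] --> A *m x.
Proof.
move=> fx; apply: cvg_mx => i k; rewrite ord1 mxE.
under eq_fun do rewrite mxE.
apply: cvg_sum => j; apply: cvgMr.
exact: (cvg_comp _ _ fx (@coord_continuous R _ _ j 0 x)).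
Qed.

(** This turns square-root bounds into convergence: [sqrt f] tends to [sqrt s], and squaring
    recovers [f] where [f] is nonnegative. *)
Lemma cvg_sqrtr_dist (R : realType) (T : Type) (F : set_system T)
    {FF : Filter F} (s : R) (f g : T -> R) :
  0 <= s ->
  (\forall x \near F, 0 <= f x /\ (Num.sqrt s - Num.sqrt (f x)) ^+ 2 <= g x) ->
  g @ F --> 0 -> f @ F --> s.
Proof.
move=> s0 fg g0.
have sg : Num.sqrt (g x) @[x --> F] --> 0.
  by rewrite -(@sqrtr0 R); apply: cvg_comp g0 _; exact: sqrt_continuous.
have sf : Num.sqrt (f x) @[x --> F] --> Num.sqrt s.
  apply/cvgrPdist_le => e e0; move/cvgr0Pnorm_le/(_ _ e0): sg => sg.
  near=> x; have [_ fx] : 0 <= f x /\ (Num.sqrt s - Num.sqrt (f x)) ^+ 2 <= g x.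
    by near: x.
  rewrite -sqrtr_sqr; apply: le_trans (_ : `|Num.sqrt (g x)| <= e).
    by rewrite ger0_norm ?sqrtr_ge0// ler_wsqrtr.
  by near: x.
have := @cvgM _ _ F FF _ _ _ _ sf sf; rewrite -expr2 sqr_sqrtr//.
apply: cvg_trans; apply: near_eq_cvg; near=> x.
have [fx0 _] : 0 <= f x /\ (Num.sqrt s - Num.sqrt (f x)) ^+ 2 <= g x by near: x.
by rewrite /= -expr2 sqr_sqrtr.
Unshelve. all: end_near. Qed.

Lemma cvg_invr_pinfty (R : realFieldType) : x^-1 @[x --> +oo] --> (0 : R).
Proof.
by apply/(@gtr0_cvgV0 R R +oo _ id); [exact: nbhs_pinfty_gt|exact: cvg_id].
Qed.

(** * The square-root bound and the Kullback-Leibler divergence *)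

Lemma sqrtr_dist_kl (R : realType) (s t : R) : 0 <= s -> 0 < t ->
  (Num.sqrt s - Num.sqrt t) ^+ 2 <= s * ln (s / t) + t - s.
Proof.
rewrite le_eqVlt => /predU1P[<-|s0] t0.
  by rewrite sqrtr0 sub0r sqrrN (sqr_sqrtr (ltW t0)) mul0r add0r subr0.
set a := Num.sqrt s; set b := Num.sqrt t.
have a0 : 0 < a by rewrite sqrtr_gt0.
have b0 : 0 < b by rewrite sqrtr_gt0.
have sE : s = a ^+ 2 by rewrite sqr_sqrtr ?ltW.
have tE : t = b ^+ 2 by rewrite sqr_sqrtr ?ltW.
(* Since [s ln (s / t) = - 2 a^2 ln (b / a)], this tangent bound gives
   [s ln (s / t) >= 2 a^2 - 2 a b]; adding [b^2 - a^2] completes the square. *)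
have ba : ln (b / a) <= b / a - 1.
  have := @le_ln1Dx R (b / a - 1); rewrite [1 + _]addrC subrK; apply.
  by rewrite ltrBrDr addrC subrr divr_gt0.
have -> : s / t = (b / a) ^- 2.
  by rewrite sE tE; field; rewrite ?gt_eqF.
rewrite lnV ?posrE ?exprn_gt0 ?divr_gt0// lnXn ?divr_gt0//.
have : a ^+ 2 * ln (b / a) <= a ^+ 2 * (b / a - 1).
  by rewrite ler_pM2l// exprn_gt0.
have -> : a ^+ 2 * (b / a - 1) = a * b - a ^+ 2.
  by field; rewrite ?gt_eqF.
rewrite sE tE; set w := ln _; rewrite mulr2n; lra.
Qed.

Lemma sqrtr_dist_xlog (R : realType) (s t : R) : 0 <= s -> 0 <= t ->
  (((Num.sqrt s - Num.sqrt t) ^+ 2)%:E <= xlog_ratio s t + t%:E - s%:E)%E.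
Proof.
move=> s0 t0; rewrite /xlog_ratio; have [->|sn0] := eqVneq s 0.
  by rewrite sqrtr0 sub0r sqrrN sqr_sqrtr// add0e sube0.
have [->|tn0] := eqVneq t 0; first by rewrite adde0 addye ?leey.
by rewrite lee_fin sqrtr_dist_kl// lt_def tn0.
Qed.

Lemma KL_div_ge_term (R : realType) (N M : nat) (H : 'M[R]_(N, M))
    (y : 'cV[R]_N) (x : 'cV[R]_M) (i : 'I_N) :
  (forall i, 0 <= y i 0) -> (forall i, 0 <= (H *m x) i 0) ->
  (((Num.sqrt (y i 0) - Num.sqrt ((H *m x) i 0)) ^+ 2)%:E <= KL_div H y x)%E.
Proof.
move=> y0 Hx0; rewrite /KL_div (bigD1 i)//= -[leLHS]adde0.
rewrite leeD ?sqrtr_dist_xlog//.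
apply: sume_ge0 => k _; apply: le_trans _ (sqrtr_dist_xlog _ _) => //.
by rewrite lee_fin sqr_ge0.
Qed.

Lemma KL_div_ge0 (R : realType) (N M : nat) (H : 'M[R]_(N, M))
    (y : 'cV[R]_N) (x : 'cV[R]_M) :
  (forall i, 0 <= y i 0) -> (forall i, 0 <= (H *m x) i 0) ->
  (0 <= KL_div H y x)%E.
Proof.
move=> y0 Hx0; apply: sume_ge0 => k _.
apply: le_trans _ (sqrtr_dist_xlog _ _) => //.
by rewrite lee_fin sqr_ge0.
Qed.

(** Real-valued weighted divergence: weights 1 compare data, weights [H^T 1] compare iterates. A
    zero entry of [t] facing a positive one of [s] gives a finite value here, so [kl] replaces
    [KL_div] only where [H x] has no zero entry. *)
Definition kl (R : realType) (n : nat) (w s t : 'cV[R]_n) : R :=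
  \sum_i w i 0 * (s i 0 * ln (s i 0 / t i 0) + t i 0 - s i 0).

Lemma KL_div_kl (R : realType) (N M : nat) (H : 'M[R]_(N, M))
    (y : 'cV[R]_N) (x : 'cV[R]_M) :
  (forall i, (H *m x) i 0 != 0) ->
  KL_div H y x = (kl (const_mx 1) y (H *m x))%:E.
Proof.
move=> Hx0; rewrite /kl -sumEFin; apply: eq_bigr => i _.
rewrite [const_mx _ _ _]mxE mul1r /xlog_ratio; have [->|y0] := eqVneq.
  by rewrite mul0r !add0r.
by rewrite (negPf (Hx0 i)).
Qed.

Lemma klZ (R : realType) (n : nat) (w s t : 'cV[R]_n) (L : R) :
  L != 0 -> kl w (L *: s) (L *: t) = L * kl w s t.
Proof.
move=> L0; rewrite /kl mulr_sumr; apply: eq_bigr => i _; rewrite !mxE.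
rewrite -mulf_div divff// mul1r; ring.
Qed.

Lemma kl_ge0 (R : realType) (n : nat) (w s t : 'cV[R]_n) :
  (forall i, 0 <= w i 0) -> (forall i, 0 <= s i 0) -> (forall i, 0 < t i 0) ->
  0 <= kl w s t.
Proof.
move=> w0 s0 t0; apply: sumr_ge0 => i _; apply: mulr_ge0 => //.
exact: le_trans (sqr_ge0 _) (sqrtr_dist_kl _ _).
Qed.

Lemma kl_ge_term (R : realType) (n : nat) (w s t : 'cV[R]_n) :
  (forall i, 0 < w i 0) -> (forall i, 0 <= s i 0) -> (forall i, 0 < t i 0) ->
  forall i, w i 0 * (Num.sqrt (s i 0) - Num.sqrt (t i 0)) ^+ 2 <= kl w s t.
Proof.
move=> w0 s0 t0 i; rewrite /kl (bigD1 i)//= -[leLHS]addr0 lerD//.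
  by rewrite ler_pM2l// sqrtr_dist_kl.
apply: sumr_ge0 => j _; apply: mulr_ge0; first exact: ltW.
exact: le_trans (sqr_ge0 _) (sqrtr_dist_kl _ _).
Qed.

(** Where [s i 0 = 0] the logarithmic term vanishes identically; elsewhere the ratio tends to 1,
    where [ln] is continuous. *)
Lemma cvg_kl0 (R : realType) (T : Type) (F : set_system T) {FF : Filter F}
    (n : nat) (w s : 'cV[R]_n) (f : T -> 'cV[R]_n) :
  (forall i, 0 <= s i 0) -> f @ F --> s -> kl w s (f x) @[x --> F] --> 0.
Proof.
move=> s0 fs.
have -> : 0 = \sum_i w i 0 * (s i 0 * 0 + s i 0 - s i 0).
  by rewrite big1// => i _; rewrite mulr0 add0r subrr mulr0.
apply: cvg_sum => i; apply: cvgMr; apply: cvgB; last exact: cvg_cst.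
have fsi : f x i 0 @[x --> F] --> s i 0.
  exact: (cvg_comp _ _ fs (@coord_continuous R _ _ i 0 s)).
apply: cvgD => //.
have [->|si0] := eqVneq (s i 0) 0.
  by under eq_fun do rewrite mul0r; rewrite mul0r; exact: cvg_cst.
apply: cvgMr; have sf1 : s i 0 / f x i 0 @[x --> F] --> (1 : R).
  by rewrite -(divff si0); apply: cvgMr; exact: cvgV.
by rewrite -(@ln1 R); apply: (cvg_comp _ _ sf1); exact: continuous_ln.
Qed.

(** Jensen's inequality, from the tangent bound [ln (a i / A) <= a i / A - 1] at the weighted mean
    [A]: after weighting and summing, the right side cancels. *)
Lemma sum_ln_le (R : realType) (n : nat) (w a : 'I_n -> R) :
  (0 < n)%N -> (forall i, 0 < w i) -> (forall i, 0 < a i) ->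
  \sum_i w i * ln (a i)
    <= (\sum_i w i) * ln ((\sum_i w i * a i) / \sum_i w i).
Proof.
case: n w a => // n w a _ w0 a0.
set W := \sum_i w i; set A := _ / W.
have W0 : 0 < W by apply: (@sumr_gt0 _ _ _ ord0) => // i; exact: ltW.
have WA : \sum_i w i * a i = W * A by rewrite mulrC divfK// gt_eqF.
have A0 : 0 < A.
  rewrite divr_gt0// (sumr_gt0 (i := ord0)) ?mulr_gt0// => i.
  by rewrite ltW ?mulr_gt0.
apply: (@le_trans _ _ (\sum_i (w i * ln A + (w i * a i / A - w i)))).
  apply: ler_sum => i _.
  have := @le_ln1Dx R (a i / A - 1); rewrite [1 + _]addrC subrK.
  rewrite ltrBrDr addrC subrr divr_gt0// => /(_ isT).
  rewrite ln_div ?posrE// lerBlDr -(ler_pM2l (w0 i)) => /le_trans; apply.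
  by rewrite !mulrDr mulrN1 mulrA addrC.
rewrite big_split/= -mulr_suml sumrB -mulr_suml WA.
by rewrite mulfK ?gt_eqF// subrr addr0.
Qed.

(** * Algebra of one EM step and its descent inequality *)

Section EM.
Variables (R : realType) (N M : nat) (H : 'M[R]_(N, M)).
Hypothesis H_gt0 : forall i j, 0 < H i j.
Implicit Types (x p : 'cV[R]_M) (y : 'cV[R]_N) (L : R).

Local Notation c := (H^T *m const_mx 1 : 'cV[R]_M).

Lemma trmx_mul1E j : c j 0 = \sum_i H i j.
Proof. by rewrite mxE; apply: eq_bigr => i _; rewrite !mxE mulr1. Qed.

Lemma EM_stepE y x j : EM_step H y x j 0 =
  x j 0 / c j 0 * \sum_i H i j * (y i 0 / (H *m x) i 0).
Proof.
rewrite [LHS]mxE; congr (_ * _); rewrite [LHS]mxE.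
by apply: eq_bigr => i _; rewrite [H^T _ _]mxE [(\col__ _) _ _]mxE.
Qed.

Lemma trmx_mul1_gt0 j : (0 < N)%N -> 0 < c j 0.
Proof.
move=> N0; rewrite trmx_mul1E (sumr_gt0 (i := Ordinal N0))// => i.
by rewrite ltW.
Qed.

Lemma trmx_mul1_ge0 j : 0 <= c j 0.
Proof. by rewrite trmx_mul1E sumr_ge0// => i _; exact: ltW. Qed.

Lemma mulmx_ge0 x i : (forall j, 0 <= x j 0) -> 0 <= (H *m x) i 0.
Proof. by move=> x0; rewrite mxE sumr_ge0// => j _; rewrite mulr_ge0// ltW. Qed.

Lemma mulmx_gt0 x i : (forall j, 0 <= x j 0) -> x != 0 -> 0 < (H *m x) i 0.
Proof.
move=> x0 /cV0Pn[j xj]; rewrite mxE (sumr_gt0 (i := j))// => [k|].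
  by rewrite mulr_ge0// ltW.
by rewrite mulr_gt0// lt_def xj x0.
Qed.

Lemma EM_step_ge0 y x : (forall i, 0 <= y i 0) -> (forall j, 0 <= x j 0) ->
  forall j, 0 <= EM_step H y x j 0.
Proof.
move=> y0 x0 j; rewrite EM_stepE mulr_ge0 ?divr_ge0 ?trmx_mul1_ge0//.
by apply: sumr_ge0 => i _; rewrite mulr_ge0 ?divr_ge0 ?mulmx_ge0// ltW.
Qed.

Lemma EM_step_gt0 y x : (0 < N)%N -> (forall i, 0 < y i 0) ->
  (forall j, 0 < x j 0) ->
  forall j, 0 < EM_step H y x j 0.
Proof.
move=> N0 y0 x0 j; rewrite EM_stepE.
have t0 i : 0 < H i j * (y i 0 / (H *m x) i 0).
  rewrite mulr_gt0 ?divr_gt0 ?mulmx_gt0// => [k|]; first exact: ltW.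
  by apply/cV0Pn; exists j; rewrite gt_eqF.
rewrite mulr_gt0 ?divr_gt0 ?trmx_mul1_gt0//.
by apply: (sumr_gt0 (i := Ordinal N0)) => // i; exact: ltW.
Qed.

(** The weight [c j 0] cancels the division in the step; after exchanging the sums, [(H x)_i]
    cancels too. Both the descent inequality and the boundedness of the iterates use this. *)
Lemma EM_step_mass y x : (0 < N)%N -> (forall i, (H *m x) i 0 != 0) ->
  \sum_j c j 0 * EM_step H y x j 0 = \sum_i y i 0.
Proof.
move=> N0 Hx0.
under eq_bigr => j _.
  rewrite EM_stepE mulrA mulrCA divff ?gt_eqF ?trmx_mul1_gt0// mulr1 mulr_sumr.
  over.
rewrite exchange_big/=; apply: eq_bigr => i _.
under eq_bigr => j _ do rewrite mulrA [x _ _ * _]mulrC.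
rewrite -mulr_suml -[RHS](divfK (Hx0 i)) mulrC; congr (_ * _).
by rewrite mxE.
Qed.

Lemma EM_step_scale_data y x L : EM_step H (L *: y) x = L *: EM_step H y x.
Proof.
apply/matrixP => j k; rewrite ord1 [RHS]mxE !EM_stepE mulrCA; congr (_ * _).
rewrite mulr_sumr; apply: eq_bigr => i _; rewrite [(L *: y) _ _]mxE; ring.
Qed.

Lemma EM_step_scale_point y x L : L != 0 ->
  EM_step H y (L *: x) = EM_step H y x.
Proof.
move=> L0; apply/matrixP => j k; rewrite ord1 !EM_stepE !mulr_sumr.
apply: eq_bigr => i _; rewrite -scalemxAr [(L *: x) j 0]mxE.
rewrite [(L *: (H *m x)) i 0]mxE.
rewrite invfM; move: ((H *m x) i 0)^-1 (_ j 0)^-1 => t d; by field.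
Qed.

Lemma EM_step_fixed y x : (0 < N)%N -> (forall i, (H *m x) i 0 != 0) ->
  H *m x = y -> EM_step H y x = x.
Proof.
move=> N0 Hx0 <-; apply/matrixP => j k; rewrite ord1 EM_stepE.
under eq_bigr => i _ do rewrite divff// mulr1.
by rewrite -trmx_mul1E divfK// gt_eqF// trmx_mul1_gt0.
Qed.

(** The ratio [x'_j / x_j] is the mean of [y_i / (H x)_i] with weights [H_ij / c_j], so Jensen
    bounds its logarithm below. Averaging against [p] turns the weights into [H p = y]. *)
Lemma kl_EM_step p x : (0 < N)%N -> (forall j, 0 <= p j 0) ->
  (forall i, 0 < (H *m p) i 0) -> (forall j, 0 < x j 0) ->
  kl c p (EM_step H (H *m p) x) + kl (const_mx 1) (H *m p) (H *m x) <= kl c p x.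
Proof.
move=> N0 p0 y0 x0; set y := H *m p; set x' := EM_step H y x.
have x'0 j : 0 < x' j 0 by exact: EM_step_gt0.
have c0 j : 0 < c j 0 by exact: trmx_mul1_gt0.
have Hx0 i : 0 < (H *m x) i 0.
  have /cV0Pn[j _] : p != 0.
    by apply: contraTneq (y0 i) => ->; rewrite mulmx0 mxE ltxx.
  apply: mulmx_gt0 => [k|]; first exact: ltW.
  by apply/cV0Pn; exists j; rewrite gt_eqF.
pose l i := ln (y i 0 / (H *m x) i 0).
have step j : p j 0 * \sum_i H i j * l i <=
    c j 0 * (p j 0 * ln (x' j 0 / x j 0)).
  rewrite mulrCA ler_wpM2l//.
  have := @sum_ln_le R N (H^~ j) (fun i => y i 0 / (H *m x) i 0) N0.
  rewrite -trmx_mul1E => /(_ (H_gt0^~ j)).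
  move=> /(_ (fun i => divr_gt0 (y0 i) (Hx0 i))).
  move/le_trans; apply; rewrite le_eqVlt; apply/orP; left; apply/eqP.
  congr (_ * ln _).
  by rewrite /x' EM_stepE; field; rewrite !gt_eqF.
have lnp j : p j 0 * ln (p j 0 / x j 0) =
    p j 0 * ln (p j 0 / x' j 0) + p j 0 * ln (x' j 0 / x j 0).
  (* The logarithm of a quotient splits only for positive arguments, so zero entries of [p] are set
     apart. *)
  have [->|pj0] := eqVneq (p j 0) 0; first by rewrite !mul0r addr0.
  have pj : 0 < p j 0 by rewrite lt_def pj0 p0.
  by rewrite -mulrDr !ln_div ?posrE// addrA subrK.
have -> : kl c p x = kl c p x' + (\sum_j c j 0 * (p j 0 * ln (x' j 0 / x j 0))
    + \sum_j c j 0 * x j 0 - \sum_j c j 0 * x' j 0).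
  rewrite /kl -big_split -sumrB -big_split; apply: eq_bigr => j _ /=.
  by rewrite lnp; ring.
rewrite lerD2l EM_step_mass// => [|i]; last by rewrite gt_eqF.
have -> : \sum_j c j 0 * x j 0 = \sum_i (H *m x) i 0.
  under eq_bigr => j _ do rewrite trmx_mul1E mulr_suml.
  by rewrite exchange_big; apply: eq_bigr => i _; rewrite mxE.
have -> : kl (const_mx 1) y (H *m x) =
    \sum_i y i 0 * l i + \sum_i (H *m x) i 0 - \sum_i y i 0.
  rewrite -big_split -sumrB; apply: eq_bigr => i _ /=.
  by rewrite [const_mx _ _ _]mxE mul1r.
(* The linear terms agree on both sides; what remains is the sum of [step] over [j], rearranged by
   [y = H p]. *)
rewrite !lerD2r; apply: le_trans (ler_sum _ (fun j _ => step j)).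
rewrite le_eqVlt; apply/orP; left; apply/eqP.
under [RHS]eq_bigr => j _ do rewrite mulr_sumr.
rewrite exchange_big/=; apply: eq_bigr => i _.
by rewrite mxE mulr_suml; apply: eq_bigr => j _; ring.
Qed.
End EM.

(** * Convergence of EM for data of the form [H p] *)

Section EM_convergence.
Variables (R : realType) (N M : nat) (H : 'M[R]_(N, M)) (x0 : 'cV[R]_M).
Hypothesis H_gt0 : forall i j, 0 < H i j.
Hypothesis x0_gt0 : forall j, 0 < x0 j 0.

Lemma EM_iterate_ge0 (y : 'cV[R]_N) (k : nat) : (forall i, 0 <= y i 0) ->
  forall j, 0 <= EM_iterate H x0 y k j 0.
Proof.
move=> y0; elim: k => [j|k IH]; first exact: ltW.
exact: EM_step_ge0.
Qed.

Lemma EM_iterate_gt0 (y : 'cV[R]_N) (k : nat) : (0 < N)%N ->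
  (forall i, 0 < y i 0) ->
  forall j, 0 < EM_iterate H x0 y k j 0.
Proof.
move=> N0 y0; elim: k => [j|k IH]; first exact: x0_gt0.
exact: EM_step_gt0.
Qed.

(** A step is linear in the data and of degree 0 in the current point. Index 0 is left out, since
    the initialization does not scale with [L]. *)
Lemma EM_iterate_scale (y : 'cV[R]_N) (L : R) (k : nat) : L != 0 ->
  EM_iterate H x0 (L *: y) k.+1 = L *: EM_iterate H x0 y k.+1.
Proof.
move=> L0; elim: k => [|k IH]; first exact: EM_step_scale_data.
by rewrite /EM_iterate iterS -/(EM_iterate _ _ _ _) IH EM_step_scale_data
  EM_step_scale_point.
Qed.

Lemma EM_iterate_fixed (y : 'cV[R]_N) (k n : nat) :
  EM_step H y (EM_iterate H x0 y k) = EM_iterate H x0 y k ->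
  EM_iterate H x0 y (n + k) = EM_iterate H x0 y k.
Proof.
move=> Ek; elim: n => // n IH.
by rewrite addSn /EM_iterate iterS -/(EM_iterate _ _ _ _) IH.
Qed.

Variable p : 'cV[R]_M.
Hypothesis N_gt0 : (0 < N)%N.
Hypothesis p_ge0 : forall j, 0 <= p j 0.
Hypothesis p_neq0 : p != 0.

Local Notation c := (H^T *m const_mx 1 : 'cV[R]_M).
Local Notation y := (H *m p).
Local Notation x := (EM_iterate H x0 y).

Lemma mulmx_EM_iterate_gt0 (k : nat) i : 0 < (H *m x k) i 0.
Proof.
have x_gt0 j : 0 < x k j 0 by apply: EM_iterate_gt0 => // i'; exact: mulmx_gt0.
apply: mulmx_gt0 => // [j|]; first exact: ltW.
by have /cV0Pn[j _] := p_neq0; apply/cV0Pn; exists j; rewrite gt_eqF.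
Qed.

(** The weighted divergence from [q] is nonincreasing and nonnegative, so its decrements tend to 0,
    and they dominate the data divergence. The vector [q] stays free, to be taken as [p] and then as
    a cluster point. *)
Lemma EM_iterate_descent (q : 'cV[R]_M) :
  (forall j, 0 <= q j 0) -> H *m q = y ->
  [/\ kl c q (x k) @[k --> \oo] --> limn (fun k => kl c q (x k)) &
      kl (const_mx 1) y (H *m x k) @[k --> \oo] --> 0].
Proof.
move=> q0 Hq; have y0 i : 0 < y i 0 by exact: mulmx_gt0.
have x_gt0 k j : 0 < x k j 0 by exact: EM_iterate_gt0.
have Hx0 k i := mulmx_EM_iterate_gt0 k i.
have KL0 k : 0 <= kl (const_mx 1) y (H *m x k).
  by apply: kl_ge0 => // i; [rewrite mxE|exact: ltW].
have step k : kl c q (x k.+1) + kl (const_mx 1) y (H *m x k) <= kl c q (x k).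
  by have := @kl_EM_step _ _ _ _ H_gt0 q (x k) N_gt0 q0; rewrite Hq; exact.
have cv : cvgn (fun k => kl c q (x k)).
  apply: nonincreasing_is_cvgn.
    apply/nonincreasing_seqP => k.
    by apply: le_trans (step k); rewrite lerDl.
  exists 0 => _ [k _ <-]; apply: kl_ge0 => // j; exact: trmx_mul1_ge0.
split; first exact: cv.
apply: (@squeeze_cvgr _ _ _ _ (fun=> 0)
  (fun k => kl c q (x k) - kl c q (x k.+1))).
- by apply: nearW => k; rewrite KL0 lerBrDl step.
- exact: cvg_cst.
rewrite -(subrr (limn (fun k => kl c q (x k)))); apply: cvgB => //.
by rewrite (cvg_shiftS (fun k => kl c q (x k))).
Qed.

Lemma EM_iterate_cvg : exists xhat : 'cV[R]_M,
  [/\ nonneg_orthant R M xhat, H *m xhat = y & x @ \oo --> xhat].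
Proof.
have y0 i : 0 < y i 0 by exact: mulmx_gt0.
have x_gt0 k j : 0 < x k j 0 by exact: EM_iterate_gt0.
have Hx0 k i := mulmx_EM_iterate_gt0 k i.
have c0 j : 0 < c j 0 by exact: trmx_mul1_gt0.
have Hx : (H *m x k) @[k --> \oo] --> y.
  apply: cvg_mx => i j; rewrite ord1.
  apply: cvg_sqrtr_dist (EM_iterate_descent p_ge0 erefl).2; first exact: ltW.
  apply: nearW => k; split; first exact: ltW.
  have := @kl_ge_term R N (const_mx 1) y (H *m x k) _ _ (Hx0 k) i.
  by rewrite mxE mul1r; apply => [i'|i']; [rewrite mxE|exact: ltW].
(* From index 1 on, mass conservation gives [c_j x_j <= m]; the term [x0] covers index 0, and the
   sum over [j] makes the bound uniform. *)
have [B xB] : exists B, forall k j, `|x k j 0| <= B.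
  pose m := \sum_i y i 0.
  exists (\sum_j (x0 j 0 + m / c j 0)) => k j.
  have m0 : 0 <= m by apply: sumr_ge0 => i _; exact: ltW.
  rewrite gtr0_norm// (bigD1 j)//= -[leLHS]addr0 lerD//; last first.
    by apply: sumr_ge0 => l _; rewrite addr_ge0 ?divr_ge0// ltW.
  case: k => [|k]; first by rewrite lerDl divr_ge0// ltW.
  rewrite -[leLHS]add0r lerD//; first exact: ltW.
  rewrite ler_pdivlMr// mulrC /m -(@EM_step_mass _ _ _ _ H_gt0 y (x k)) //.
    rewrite (bigD1 j)//= lerDl sumr_ge0// => l _.
    by rewrite mulr_ge0 ?ltW// -[EM_step _ _ _]/(x k.+1).
  by move=> i; rewrite gt_eqF.
have [xhat [phi phioo xphi]] := bounded_seq_cvg_subseq xB.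
have xhat0 j : 0 <= xhat j 0.
  apply: (cvgr_to_ge (cvg_comp _ _ xphi (@coord_continuous R _ _ j 0 xhat))).
  by apply: nearW => k /=; exact: ltW.
have Hxhat : H *m xhat = y.
  apply: (@cvg_unique _ _ ((fun n => H *m x (phi n)) @ \oo)).
  - exact: norm_hausdorff.
  - exact: cvg_mulmx.
  - exact: (cvg_comp _ _ phioo Hx).
have [Dl _] := EM_iterate_descent xhat0 Hxhat.
(* The whole sequence has a limit by monotonicity, and along [phi] it tends to 0. *)
have D0 : kl c xhat (x k) @[k --> \oo] --> 0.
  rewrite (_ : 0 = limn (fun k => kl c xhat (x k))) //.
  apply: (@cvg_unique _ _ ((fun n => kl c xhat (x (phi n))) @ \oo)).
  - exact: norm_hausdorff.
  - exact: cvg_kl0.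
  - exact: (cvg_comp _ _ phioo Dl).
exists xhat; split => //; apply: cvg_mx => j k; rewrite ord1.
apply: (@cvg_sqrtr_dist _ _ _ _ _ _ (fun k => kl c xhat (x k) / c j 0)) => //.
  apply: nearW => n; split; first exact: ltW.
  by rewrite ler_pdivlMr// mulrC; exact: kl_ge_term.
by rewrite -(mul0r (c j 0)^-1); apply: cvgMl.
Qed.
End EM_convergence.

(** * The discrepancy criterion for the data [L y] as [L] grows *)

Section Discrepancy.
Variables (R : realType) (N M : nat) (H : 'M[R]_(N, M)) (x0 : 'cV[R]_M).
Hypothesis H_gt0 : forall i j, 0 < H i j.
Hypothesis x0_gt0 : forall j, 0 < x0 j 0.
Variables (tau : R) (y : 'cV[R]_N).
Hypothesis N_gt0 : (0 < N)%N.
Hypothesis y_ge0 : forall i, 0 <= y i 0.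

Local Notation z L k := (L^-1 *: EM_iterate H x0 (L *: y) k).

(** A single squared distance is at most the whole divergence, hence at most [tau N / 2]; it is
    homogeneous of degree 1, which yields the factor [L^-1]. *)
Lemma sqrtr_dist_discrepancy (L : R) (k : nat) (i : 'I_N) : 0 < L ->
  poisson_discrepancy H x0 tau (L *: y) k ->
  (Num.sqrt (y i 0) - Num.sqrt ((H *m z L k) i 0)) ^+ 2 <=
    tau * N%:R / 2 * L^-1.
Proof.
move=> L0 crit; set x := EM_iterate H x0 (L *: y) k.
have Ly0 i' : 0 <= (L *: y) i' 0 by rewrite mxE mulr_ge0// ltW.
have x_ge0 j : 0 <= x j 0 by exact: EM_iterate_ge0.
have := KL_div_ge_term i Ly0 (fun i => mulmx_ge0 H_gt0 i x_ge0).
have N0 : 0 < N%:R :> R by rewrite ltr0n.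
have c0 : (0 <= (2 / N%:R)%:E :> \bar R)%E by rewrite lee_fin divr_ge0// ltW.
move=> /(lee_wpmul2l c0)/le_trans/(_ crit); rewrite -EFinM lee_fin.
have {1}-> : x = L *: z L k by rewrite scalerA divff ?gt_eqF// scale1r.
rewrite -scalemxAr [(L *: y) i 0]mxE [(L *: (H *m z L k)) i 0]mxE.
rewrite !(sqrtrM _ (ltW L0)) -mulrBr exprMn (sqr_sqrtr (ltW L0)).
set d := (_ - _) ^+ 2.
have -> : 2 / N%:R * (L * d) = d * L * 2 / N%:R by ring.
by rewrite ler_pdivrMr// !ler_pdivlMr.
Qed.

Lemma cvg_tau_div : tau * N%:R / 2 * L^-1 @[L --> +oo] --> 0.
Proof.
rewrite -(mulr0 (tau * N%:R / 2)); apply: cvgMr.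
exact: cvg_invr_pinfty.
Qed.

(** At an entry where [H z0] and [y] differ, the square-root distance has a positive limit, whereas
    the criterion would force it below a quantity tending to 0. *)
Lemma not_discrepancy_near (k : nat) (z0 : 'cV[R]_M) :
  (forall j, 0 <= z0 j 0) -> z L k @[L --> +oo] --> z0 -> H *m z0 != y ->
  \forall L \near +oo, ~ poisson_discrepancy H x0 tau (L *: y) k.
Proof.
move=> z0_ge0 zz0 Hz0; have /cV0Pn[i] : H *m z0 - y != 0 by rewrite subr_eq0.
rewrite !mxE subr_eq0 => Hz0i.
pose d (z' : 'cV[R]_M) : R :=
  (Num.sqrt (y i 0) - Num.sqrt ((H *m z') i 0)) ^+ 2.
have d0 : 0 < d z0.
  rewrite exprn_even_gt0//= subr_eq0 eq_sym; apply: contra Hz0i => /eqP Es.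
  have := congr1 (fun t => t ^+ 2) Es.
  by rewrite !sqr_sqrtr ?mulmx_ge0// mxE => ->.
have dz : d (z L k) - tau * N%:R / 2 * L^-1 @[L --> +oo] --> d z0.
  rewrite -[d z0]subr0; apply: cvgB cvg_tau_div.
  have Hzz0 : (H *m z L k) i 0 @[L --> +oo] --> (H *m z0) i 0.
    exact: (cvg_comp _ _ (cvg_mulmx zz0) (@coord_continuous R _ _ i 0 _)).
  have szz : Num.sqrt (y i 0) - Num.sqrt ((H *m z L k) i 0) @[L --> +oo]
      --> Num.sqrt (y i 0) - Num.sqrt ((H *m z0) i 0).
    apply: cvgB; first exact: cvg_cst.
    exact: (cvg_comp _ _ Hzz0 (@sqrt_continuous R _)).
  by rewrite /d; under eq_fun do rewrite expr2; rewrite expr2; exact: cvgM.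
near=> L => crit; have L0 : 0 < L by [].
have := sqrtr_dist_discrepancy i L0 crit; rewrite leNgt => /negP; apply.
rewrite -subr_gt0; near: L; exact: (cvgr_gt _ dz).
Unshelve. all: end_near. Qed.
End Discrepancy.

(** * Definedness of the iterates and the two implications *)

Lemma EM_defined_mulmx (R : realType) (N M : nat) (H : 'M[R]_(N, M))
    (x0 p : 'cV[R]_M) (k : nat) :
  (forall i j, 0 < H i j) -> (forall j, 0 < x0 j 0) -> (0 < N)%N ->
  (forall j, 0 <= p j 0) -> p != 0 -> EM_defined H x0 (H *m p) k.
Proof.
move=> H0 x00 N0 p0 pn0 l _; split=> [j|i]; rewrite gt_eqF//.
  exact: trmx_mul1_gt0.
exact: mulmx_EM_iterate_gt0.
Qed.

Unset Implicit Arguments.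

Theorem theorem3p4 (R : realType) (N M : nat) (H : 'M[R]_(N, M))
    (y : 'cV[R]_N) (tau : R) (x0 : 'cV[R]_M)
    (H_gt0 : forall i j, 0 < H i j)
    (y_ge0 : forall i, 0 <= y i 0) (y_neq0 : y != 0)
    (tau_gt0 : 0 < tau)
    (x0_gt0 : forall j, 0 < x0 j 0) :
  regularization_method H (EM_iterate H x0) (EM_defined H x0)
    (poisson_discrepancy H x0 tau) y <->
  [set H *m x | x in nonneg_orthant R M] y.
Proof.
have N_gt0 : (0 < N)%N.
  by have /cV0Pn[i _] := y_neq0; exact: leq_ltn_trans (ltn_ord i).
have N0 : 0 < N%:R :> R by rewrite ltr0n.
split.
  move=> [_ [k [kP [xhat [[xhat0 _] zcvg]]]]]; exists xhat => //.
  apply/matrixP => i j; rewrite ord1.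
  (* The same entry tends to that of [H xhat] by continuity and to that of [y] by the criterion. *)
  apply: (@cvg_unique _ _
    ((fun L => (H *m (L^-1 *: EM_iterate H x0 (L *: y) (k L))) i 0) @ +oo)).
  - exact: norm_hausdorff.
  - exact: (cvg_comp _ _ (cvg_mulmx zcvg) (@coord_continuous R _ _ i 0 _)).
  - apply: (cvg_sqrtr_dist _ _ (cvg_tau_div N tau)) => //.
    near=> L; have L0 : 0 < L by [].
    have [_ crit _] := kP L L0; split; last exact: sqrtr_dist_discrepancy.
    apply: mulmx_ge0 => // j'; rewrite mxE mulr_ge0 ?invr_ge0 ?(ltW L0)//.
    by apply: EM_iterate_ge0 => // i'; rewrite mxE mulr_ge0// ltW.
move=> [p p_ge0 yE]; subst y; set y := H *m p in y_ge0 y_neq0 *.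
have p_neq0 : p != 0 by apply: contraNneq y_neq0 => p0; rewrite /y p0 mulmx0.
have y_gt0 i : 0 < y i 0 by exact: mulmx_gt0.
split=> [x x_ge0 x_neq0 k|]; first exact: EM_defined_mulmx.
have [xhat [xhat0 Hxhat xcvg]] :=
  EM_iterate_cvg H_gt0 x0_gt0 N_gt0 p_ge0 p_neq0.
have [_ klcvg] :=
  EM_iterate_descent H_gt0 x0_gt0 N_gt0 p_ge0 p_neq0 p_ge0 erefl.
have defL L k : 0 < L -> EM_defined H x0 (L *: y) k.
  move=> L0; rewrite /y scalemxAr; apply: EM_defined_mulmx => // [j|].
    by rewrite mxE mulr_ge0// ltW.
  by rewrite scaler_eq0 negb_or gt_eqF.
(* Positivity of [L] is placed under the existential so that [choice] yields a function on all of
   [R]; its value for [L <= 0] is arbitrary. *)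
have stop L : exists k, 0 < L ->
    stopping_index (EM_defined H x0 (L *: y))
      (poisson_discrepancy H x0 tau (L *: y)) k.
  have [L0|L0] := ltP 0 L; last by exists 0%N.
  have exk : exists k, `[< poisson_discrepancy H x0 tau (L *: y) k >].
    (* By homogeneity the criterion for [L y] reads [2 / N * L * kl <= tau] at positive indices,
       hence the threshold [tau / (2 / N * L)] and the index [K.+1]. *)
    have w0 : 0 < 2 / N%:R * L by rewrite mulr_gt0// divr_gt0.
    have e0 := divr_gt0 tau_gt0 w0.
    have /cvgr0Pnorm_le/(_ _ e0)[K _ KP] := klcvg.
    exists K.+1; apply/asboolP; rewrite /poisson_discrepancy.
    rewrite EM_iterate_scale ?gt_eqF//.
    rewrite KL_div_kl => [|i]; last first.
      by rewrite -scalemxAr mxE mulf_neq0 ?gt_eqF// mulmx_EM_iterate_gt0.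
    rewrite -scalemxAr klZ ?gt_eqF// -EFinM lee_fin mulrA.
    rewrite mulrC -(ler_pdivlMr _ _ w0).
    exact: le_trans (ler_norm _) (KP K.+1 (leqnSn K)).
  exists (ex_minn exk) => _; case: ex_minnP => k /asboolP kcrit kmin.
  split=> // [|l lk [_ lcrit]]; first exact: defL.
  by have := kmin l (asboolT lcrit); rewrite leqNgt lk.
have [k kP] := choice stop; exists k; split=> //; exists xhat; split.
  (* The divergence vanishes at [xhat], as [H xhat = y], and is nonnegative elsewhere. *)
  split=> // z z0; rewrite KL_div_kl => [|i]; last by rewrite Hxhat gt_eqF.
  rewrite Hxhat (_ : kl _ _ _ = 0).
    by apply: KL_div_ge0 => // i; exact: mulmx_ge0.
  by apply: big1 => i _; rewrite divff ?gt_eqF// ln1 mulr0 add0r subrr mulr0.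
move=> U Uxhat; have [K _ KP] := xcvg _ Uxhat.
(* Iterates of index at least [K] already lie in [U]. For the finitely many indices up to [K], one
   range of large [L] works for all of them. *)
have small : \forall L \near +oo, forall n : 'I_K.+1,
    poisson_discrepancy H x0 tau (L *: y) n ->
    U (L^-1 *: EM_iterate H x0 (L *: y) n).
  apply: filter_forall => -[[|n] /= _].
    (* At index 0 the rescaled iterate [x0 / L] tends to 0, and [H 0 = 0] differs from [y]. *)
    have z0 : L^-1 *: EM_iterate H x0 (L *: y) 0 @[L --> +oo] -->
        (0 : 'cV[R]_M).
      apply: cvg_mx => i j; rewrite mxE -(mul0r (x0 i j)).
      by under eq_fun do rewrite mxE; apply: cvgMl; exact: cvg_invr_pinfty.
    have := @not_discrepancy_near R N M H x0 H_gt0 x0_gt0 tau y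
      N_gt0 y_ge0 0 0 _ z0.
    rewrite mulmx0 eq_sym => /(_ _ y_neq0) near0.
    by apply: filterS (near0 _) => [L nL /nL//|j]; rewrite mxE.
  have zE L : 0 < L ->
      L^-1 *: EM_iterate H x0 (L *: y) n.+1 = EM_iterate H x0 y n.+1.
    move=> L0; rewrite EM_iterate_scale ?gt_eqF//.
    by rewrite scalerA mulVf ?gt_eqF// scale1r.
  have [Hn|Hn] := eqVneq (H *m EM_iterate H x0 y n.+1) y.
    near=> L; have L0 : 0 < L by []. move=> _; rewrite zE//.
    suff -> : EM_iterate H x0 y n.+1 = xhat by exact: nbhs_singleton.
    (* An exact match of the data makes the iterates constant from here on, so this iterate is their
       limit. *)
    have xn : EM_iterate H x0 y @ \oo --> EM_iterate H x0 y n.+1; last first.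
      apply/matrixP => i j; apply: (@cvg_unique _ _
        ((fun m => EM_iterate H x0 y m i j) @ \oo)).
      - exact: norm_hausdorff.
      - exact: (cvg_comp _ _ xn (@coord_continuous R _ _ i j _)).
      - exact: (cvg_comp _ _ xcvg (@coord_continuous R _ _ i j _)).
    apply: cvg_near_cst; near=> m.
    have /subnK <- : (n.+1 <= m)%N by near: m; exists n.+1.
    apply: EM_iterate_fixed; apply: EM_step_fixed => // i.
    by rewrite Hn gt_eqF.
  have zn : L^-1 *: EM_iterate H x0 (L *: y) n.+1 @[L --> +oo] -->
      EM_iterate H x0 y n.+1.
    by apply: cvg_near_cst; near=> L; apply: zE.
  have near0 := @not_discrepancy_near R N M H x0 H_gt0 x0_gt0 tau y
    N_gt0 y_ge0 _ _ _ zn Hn.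
  apply: filterS (near0 _) => [L nL /nL//|j]; exact/ltW/EM_iterate_gt0.
suff : \forall L \near +oo, U (L^-1 *: EM_iterate H x0 (L *: y) (k L)) by [].
near=> L; have L0 : 0 < L by [].
have [_ crit _] := kP L L0.
have [kK|Kk] := ltnP (k L) K.+1.
  suff: forall n : 'I_K.+1, poisson_discrepancy H x0 tau (L *: y) n ->
      U (L^-1 *: EM_iterate H x0 (L *: y) n) by move=> /(_ (Ordinal kK)); apply.
  by near: L.
(* Here [k L] exceeds [K], so it is a successor and the scaling identity applies. *)
case: (k L) Kk => // n Kn.
rewrite EM_iterate_scale ?gt_eqF// scalerA mulVf ?gt_eqF// scale1r.
by apply: KP; exact: ltnW.
Unshelve. all: end_near. Qed.
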